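(* Fix any $\varepsilon \ge 0$. Assume (A1), (A2) and (A3), and let $x^*$ denote the (existing and unique) root of $F_\varepsilon$. Let $\{x^k\}$, $\{\Delta x^k\}$ be generated by FBRS with this fixed $\varepsilon$, and let $e^k = x^k - x^*$. Then there exist $\eta > 0$ and a neighbourhood $U$ of $x^*$ such that if $x^0 \in U$, then the bound $\|e^{k+1}\| \le \eta \|e^k\|^2$ holds for all $k$, and $\{x^k\} \subset U$ converges quadratically to $x^*$.
   Context: Norms are two-norms. Data: $H \in \mathbb{R}^{n\times n}$ symmetric positive semidefinite, $f \in \mathbb{R}^n$, $A \in \mathbb{R}^{q\times n}$ with rows $A_i$, $b \in \mathbb{R}^q$. The quadratic program (QP) is: minimize $\frac12 z^T H z + f^T z$ subject to $Az \le b$. Write $x = (z,v) \in \mathbb{R}^{n+q}$ and $y = b - Az$. A KKT point is $(z,v)$ with $Hz + f + A^T v = 0$, $v \ge 0$, $y \ge 0$, $v_i y_i = 0$ for all $i$. Assumptions. (A1) There is a KKT point $(\hat z,\hat v)$ satisfying the strong second order sufficient conditions: $u^T H u > 0$ for all $u \ne 0$ with $A_i u = 0$ for every $i$ such that $A_i \hat z = b_i$ and $\hat v_i > 0$. (A2) LICQ holds at this point: the rows $A_i$ with $A_i \hat z = b_i$ are linearly independent. (A3) $\ker H \cap \ker A = \{0\}$. Fischer-Burmeister mapping: $\phi_\varepsilon(a,b) = a + b - \sqrt{a^2+b^2+\varepsilon^2}$ (applied elementwise to vectors), and $F_\varepsilon(x) = \begin{bmatrix} Hz + f + A^T v \\ \phi_\varepsilon(v,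 y)\end{bmatrix}$, $\theta_\varepsilon(x) = \frac12\|F_\varepsilon(x)\|^2$. Under (A1)-(A3), $F_\varepsilon$ has a unique root for each $\varepsilon\ge 0$. C-differential: $\partial_C F_\varepsilon(x)$ is the set of matrices whose $i$-th row is (the transpose of) an element of the Clarke generalized gradient of the $i$-th component of $F_\varepsilon$ at $x$; for $\varepsilon > 0$ it equals $\{\nabla_x F_\varepsilon(x)\}$, the Jacobian. Regularization: $R(x,\delta) = \begin{bmatrix} 0 \\ \delta (v + y)\end{bmatrix}$, $\delta \ge 0$, with Jacobian $\nabla_x R(x,\delta)$. FBRS (semismooth variant with fixed $\varepsilon\ge 0$): given parameters $\sigma \in (0,0.5)$, $\beta\in(0,1)$, an initial regularization $\delta^{-1} \ge 0$ and $x^0 \in \mathbb{R}^{n+q}$, at iteration $k = 0,1,2,\dots$: set $\delta^k = \min(\delta^{k-1}, \|F_\varepsilon(x^k)\|)$; choose $V_k \in \partial_C F_\varepsilon(x^k)$ and set $K_k = V_k + \nabla_x R(x^k,\delta^k)$; solve $K_k \Delta x^k = -F_\varepsilon(x^k)$; let $t^k$ be the first element of $1,\beta,\beta^2,\dots$ satisfying $\theta_\varepsilon(x^k + t\Delta x^k) \le (1-2t\sigma)\theta_\varepsilon(x^k)$; set $x^{k+1} = x^k + t^k \Delta x^k$. The regularization is implicitly assumed small enough that the line search does not fail. *)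

(* Defs.v *)
From HB Require Import structures.
From mathcomp Require Import all_boot all_order all_algebra.
From mathcomp Require Import all_classical all_reals all_analysis.

Set Implicit Arguments.
Unset Strict Implicit.
Unset Printing Implicit Defensive.

Import Order.TTheory GRing.Theory Num.Theory.
Import numFieldNormedType.Exports.

Local Open Scope classical_set_scope.
Local Open Scope ring_scope.

(* The library norm `|x| of a column vector is the sup norm. *)
Definition norm2 (R : realType) (N : nat) (x : 'cV[R]_N) : R :=
  Num.sqrt (\sum_(i < N) x i 0 ^+ 2).

Definition gradient (R : realType) (N : nat) (g : 'cV[R]_N -> R)
    (x : 'cV[R]_N) : 'cV[R]_N :=
  \col_(j < N) 'D_(delta_mx j 0) g x.

(* Row i is the transposed gradient of the i-th component; the library's
   [jacobian] is for maps between row vectors and has the transposed layout. *)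
Definition jacobian_col (R : realType) (N M : nat)
    (G : 'cV[R]_N -> 'cV[R]_M) (x : 'cV[R]_N) : 'M[R]_(M, N) :=
  \matrix_(i < M) (gradient (fun y => G y i 0) x)^T.

Definition convex_hull (R : realType) (E : lmodType R) (S : set E) : set E :=
  smallest (fun C : set E => convex_set (C : set (convex_lmodType E))) S.

Definition limiting_gradients (R : realType) (N : nat) (g : 'cV[R]_N -> R)
    (x : 'cV[R]_N) : set 'cV[R]_N :=
  [set xi | exists y : nat -> 'cV[R]_N,
     [/\ forall k, differentiable g (y k),
         y @ \oo --> x &
         (fun k => gradient g (y k)) @ \oo --> xi]].

(* For g locally Lipschitz near x, as every component of [FB] below is: the
   convex hull of all limits of gradients at differentiability points. *)
Definition clarke_gradient (R : realType) (N : nat) (g : 'cV[R]_N -> R)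
    (x : 'cV[R]_N) : set 'cV[R]_N :=
  convex_hull (limiting_gradients g x).

Definition C_differential (R : realType) (N M : nat)
    (G : 'cV[R]_N -> 'cV[R]_M) (x : 'cV[R]_N) : set 'M[R]_(M, N) :=
  [set V | forall i : 'I_M, clarke_gradient (fun y => G y i 0) x (row i V)^T].

Definition converges_quadratically (R : realType) (N : nat)
    (x : nat -> 'cV[R]_N) (xs : 'cV[R]_N) : Prop :=
  x @ \oo --> xs /\
  exists C : R, \forall k \near \oo,
    norm2 (x k.+1 - xs) <= C * norm2 (x k - xs) ^+ 2.

Definition psd (R : realType) (n : nat) (H : 'M[R]_n) : Prop :=
  H^T = H /\ forall u : 'cV[R]_n, 0 <= (u^T *m H *m u) 0 0.

Section QuadraticProgram.
Context (R : realType) (n q : nat).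
Context (H : 'M[R]_n) (f : 'cV[R]_n) (A : 'M[R]_(q, n)) (b : 'cV[R]_q).

Definition slack (z : 'cV[R]_n) : 'cV[R]_q := b - A *m z.

Definition kkt_point (z : 'cV[R]_n) (v : 'cV[R]_q) : Prop :=
  H *m z + f + A^T *m v = 0 /\
  forall i : 'I_q,
    [/\ 0 <= v i 0, 0 <= slack z i 0 & v i 0 * slack z i 0 = 0].

Definition active (z : 'cV[R]_n) : {set 'I_q} :=
  [set i | (A *m z) i 0 == b i 0].

Definition strong_sosc (z : 'cV[R]_n) (v : 'cV[R]_q) : Prop :=
  forall u : 'cV[R]_n, u != 0 ->
    (forall i, i \in active z -> 0 < v i 0 -> row i A *m u = 0) ->
    0 < (u^T *m H *m u) 0 0.

Definition licq (z : 'cV[R]_n) : Prop :=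
  row_free (rowsub (fun k : 'I_#|active z| => enum_val k) A).

Definition trivial_joint_kernel : Prop :=
  forall u : 'cV[R]_n, H *m u = 0 -> A *m u = 0 -> u = 0.

Definition phi (eps a c : R) : R := a + c - Num.sqrt (a ^+ 2 + c ^+ 2 + eps ^+ 2).

(* A point x = (z, v) of R^(n+q) has z = usubmx x and v = dsubmx x. *)
Definition FB (eps : R) (x : 'cV[R]_(n + q)) : 'cV[R]_(n + q) :=
  col_mx (H *m usubmx x + f + A^T *m dsubmx x)
         (map2_mx (phi eps) (dsubmx x) (slack (usubmx x))).

Definition merit (eps : R) (x : 'cV[R]_(n + q)) : R :=
  2^-1 * norm2 (FB eps x) ^+ 2.

Definition regularizer (delta : R) (x : 'cV[R]_(n + q)) : 'cV[R]_(n + q) :=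
  col_mx 0 (delta *: (dsubmx x + slack (usubmx x))).

Definition sufficient_decrease (eps sigma : R) (x dx : 'cV[R]_(n + q)) (t : R)
    : Prop :=
  merit eps (x + t *: dx) <= (1 - 2 * t * sigma) * merit eps x.

(* [delta_init] is the initial regularization, of index -1. *)
Record FBRS (eps sigma beta delta_init : R) (x dx : nat -> 'cV[R]_(n + q))
    (delta t : nat -> R) (V : nat -> 'M[R]_(n + q)) : Prop := {
  FBRS_delta0 : delta 0%N = Num.min delta_init (norm2 (FB eps (x 0%N)));
  FBRS_deltaS : forall k,
    delta k.+1 = Num.min (delta k) (norm2 (FB eps (x k.+1)));
  FBRS_V : forall k, C_differential (FB eps) (x k) (V k);
  FBRS_dx : forall k,
    (V k + jacobian_col (regularizer (delta k)) (x k)) *m dx k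
      = - FB eps (x k);
  FBRS_t : forall k, exists m : nat,
    [/\ t k = beta ^+ m,
        sufficient_decrease eps sigma (x k) (dx k) (beta ^+ m) &
        forall j, (j < m)%N ->
          ~ sufficient_decrease eps sigma (x k) (dx k) (beta ^+ j)];
  FBRS_x : forall k, x k.+1 = x k + t k *: dx k
}.

End QuadraticProgram.

(* Main.v *)
Require Import Defs.
From HB Require Import structures.
From mathcomp Require Import all_boot all_order all_algebra.
From mathcomp Require Import all_classical all_reals all_analysis.
From mathcomp Require Import ring lra.

Set Implicit Arguments.
Unset Strict Implicit.
Unset Printing Implicit Defensive.

Import Order.TTheory GRing.Theory Num.Theory.
Import numFieldNormedType.Exports.

Local Open Scope classical_set_scope.
Local Open Scope ring_scope.

(** Everything rests on one observation about the scalar Fischer-Burmeister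
    function phi(a, c) = a + c - r(a, c), where r(a, c) is the Euclidean norm
    of w = (a, c, eps).  A pair (g, m) generating an element of the Clarke
    gradient at (a, c) satisfies the two equations r g = r - a, r m = r - c
    and the linear inequalities 0 <= g, m <= 2, 1/2 <= g + m; together these
    conditions, called [slope], cut out a closed convex set, and at the kink
    r = 0 the equations become vacuous.  Hence Clarke elements can be
    controlled by checking [slope] for gradients at smooth points and passing
    to limits and convex combinations ([clarke_gradient_phi]).

    For a slope (g, m) at (a, c), r times the error of linearizing phi at
    (a, c) and evaluating at (a', c') is exactly the Cauchy-Schwarz gap
    r r' - <w, w'>, which is at most |w - w'|^2 / 2.  So the error is
    O(|w - w'|^2 / r') for every base point, kinks included, and it vanishes
    when r' = 0 ([phi_linearization]).  This is the strong semismoothness at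
    the root that makes Newton's method quadratic.

    Each C-differential of the Fischer-Burmeister map is a matrix
    [newton_mx g m] with (g_i, m_i) a slope, and the regularization merely
    replaces (g, m) by (g + delta, m + delta) ([jacobian_regularizer]).
    At the root these matrices are nonsingular: in a kernel vector (dz, dv)
    the products dv_i (A dz)_i are nonnegative, so with H positive
    semidefinite they all vanish together with dz^T H dz.  If eps > 0 then
    g, m > 0, which gives A dz = 0, dv = 0 and finally dz = 0 since H and A
    share no kernel.  If eps = 0, the root is the KKT point, because monotonicity
    makes that point unique; there the strong second order condition kills dz
    and LICQ kills dv ([newton_mx_inj]).

    The extra room in the box 0 <= g, m <= 3 absorbs the regularization, and
    minimizing a residual over this compact box times the unit sphere turns
    nonsingularity at the root into the bound
    k |w| <= C |newton_mx g m w| + (defect of (g, m) as a slope at the root) |w|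
    ([uniform_regularity]).  Slopes at x have defect O(|x - xs|) at the root xs,
    so the matrices used near xs are uniformly invertible.

    Since delta <= |F(x)| = O(|x - xs|), a full step therefore lands at distance
    O(|x - xs|^2) from xs ([newton_step_bounds]).  The merit function is
    bounded below by a multiple of |x - xs|^2 and drops to O(|x - xs|^4), so
    the line search accepts t = 1 ([full_step_decrease]), and induction
    finishes the proof.  Estimates use the sup norm; the two-norm of the
    statement is compared with it only at the end. *)

(** * The scalar Fischer-Burmeister function *)

Section FischerBurmeister.
Context (R : realType) (eps : R).
Implicit Types a c g m : R.

Definition radius a c : R := Num.sqrt (a ^+ 2 + c ^+ 2 + eps ^+ 2).

(** A polyhedral superset of the Clarke gradient of [phi eps] at (a, c).  At a
    smooth point the equations single out the gradient; at the kink they are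
    void and only the box is left.  The bound g + m >= 1/2 follows from the
    unit disc around (1, 1) that contains all gradients, and keeps (g, m) away
    from the origin. *)
Definition slope a c g m : Prop :=
  [/\ radius a c * g = radius a c - a, radius a c * m = radius a c - c,
      0 <= g <= 2, 0 <= m <= 2 & 1 / 2 <= g + m].

Lemma phiE a c : phi eps a c = a + c - radius a c. Proof. by []. Qed.

Lemma radius_ge0 a c : 0 <= radius a c. Proof. exact: sqrtr_ge0. Qed.

Lemma sqr_radius a c : radius a c ^+ 2 = a ^+ 2 + c ^+ 2 + eps ^+ 2.
Proof. by rewrite sqr_sqrtr// !addr_ge0// sqr_ge0. Qed.

Lemma radius_eq0 a c : radius a c = 0 -> a = 0 /\ c = 0.
Proof.
move=> r0; have := sqr_radius a c; rewrite r0 expr0n/= => /esym/eqP.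
have := sqr_ge0 eps; have := sqr_ge0 c; have := sqr_ge0 a => h1 h2 h3 /eqP h.
by split; apply/eqP; rewrite -sqrf_eq0; apply/eqP; lra.
Qed.

(** Cauchy-Schwarz for the vectors (a, c, eps) and (a', c', eps). *)
Lemma radius_cauchy a c a' c' :
  a * a' + c * c' + eps ^+ 2 <= radius a c * radius a' c'.
Proof.
apply: le_trans (ler_norm _) _.
rewrite -(@ler_pXn2r _ 2)// ?nnegrE// ?mulr_ge0 ?radius_ge0//.
rewrite exprMn !sqr_radius real_normK ?num_real// -subr_ge0.
rewrite (_ : _ - _ = (a * c' - c * a') ^+ 2 + (a * eps - eps * a') ^+ 2 +
                    (c * eps - eps * c') ^+ 2); last by ring.
by rewrite !addr_ge0// sqr_ge0.
Qed.

Lemma radius_lipschitz a c a' c' :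
  `|radius a c - radius a' c'| <= `|a - a'| + `|c - c'|.
Proof.
rewrite -(@ler_pXn2r _ 2)// ?nnegrE ?addr_ge0//.
have h : 0 <= `|a - a'| * `|c - c'| by rewrite mulr_ge0.
have e1 : `|a - a'| ^+ 2 = (a - a') ^+ 2 by rewrite real_normK ?num_real.
have e2 : `|c - c'| ^+ 2 = (c - c') ^+ 2 by rewrite real_normK ?num_real.
have s1 := sqr_radius a c; have s2 := sqr_radius a' c'.
have cs := radius_cauchy a c a' c'.
rewrite real_normK ?num_real//.
rewrite !sqrrD !sqrrN in e1 e2 s1 s2 *; lra.
Qed.

Lemma phi_lipschitz a c a' c' :
  `|phi eps a c - phi eps a' c'| <= 2 * (`|a - a'| + `|c - c'|).
Proof.
have h := radius_lipschitz a c a' c'; rewrite !phiE.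
rewrite (_ : _ - _ = (a - a') + (c - c') - (radius a c - radius a' c')); last by ring.
apply: le_trans (ler_normB _ _) _.
have := ler_normD (a - a') (c - c'); lra.
Qed.

Lemma slope_smooth a c : 0 < radius a c ->
  slope a c (1 - a / radius a c) (1 - c / radius a c).
Proof.
move=> r0; have s := sqr_radius a c.
have s1 := sqr_ge0 a; have s2 := sqr_ge0 c; have s3 := sqr_ge0 eps.
have bnd u : u ^+ 2 <= radius a c ^+ 2 -> `|u / radius a c| <= 1.
  move=> h; rewrite normrM normfV (gtr0_norm r0) ler_pdivrMr// mul1r.
  by rewrite -(@ler_pXn2r _ 2)// ?nnegrE ?(ltW r0)// real_normK ?num_real.
have /ler_normlP[] := bnd a ltac:(lra).
have /ler_normlP[] := bnd c ltac:(lra).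
have h : (a + c) / radius a c <= 3 / 2.
  by rewrite ler_pdivrMr// leNgt; apply/negP => hlt; have := sqr_ge0 (a - c); nra.
have rn0 := lt0r_neq0 r0.
by rewrite mulrDl in h; split; [field|field|lra|lra|lra].
Qed.

Definition phi_error a c g m a' c' : R :=
  phi eps a c - phi eps a' c' - (g * (a - a') + m * (c - c')).

(** By the slope equations, r times the error collapses to r r' - <w, w'> for
    w = (a, c, eps) and w' = (a', c', eps).  Cauchy-Schwarz gives its sign, and
    r r' - <w, w'> = (|w - w'|^2 - (r - r')^2) / 2 gives its size. *)
Lemma radius_phi_error a c g m a' c' : slope a c g m ->
  `|radius a c * phi_error a c g m a' c'| <=
    (`|a - a'| + `|c - c'|) ^+ 2 / 2.
Proof.
move=> [hg hm _ _ _].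
have -> : radius a c * phi_error a c g m a' c' =
  radius a c * radius a' c' - (a * a' + c * c' + eps ^+ 2).
  have s := sqr_radius a c.
  rewrite /phi_error !phiE; ring: hg hm s.
rewrite ger0_norm ?subr_ge0 ?radius_cauchy//.
have e1 : `|a - a'| ^+ 2 = (a - a') ^+ 2 by rewrite real_normK ?num_real.
have e2 : `|c - c'| ^+ 2 = (c - c') ^+ 2 by rewrite real_normK ?num_real.
have h : 0 <= `|a - a'| * `|c - c'| by rewrite mulr_ge0.
have s1 := sqr_radius a c; have s2 := sqr_radius a' c'.
have := sqr_ge0 (radius a c - radius a' c').
rewrite !sqrrD !sqrrN in e1 e2 s1 s2 *; lra.
Qed.

(** If r >= r'/2 divide the bound of [radius_phi_error] by r.  Otherwise
    |w - w'| >= r'/2, and the Lipschitz bound is already quadratic.  When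
    r' = 0 the error is zero by homogeneity, in agreement with the value 0 that
    the bound takes because 4 / 0 = 0. *)
Lemma phi_linearization a c g m a' c' : slope a c g m ->
  `|phi_error a c g m a' c'| <=
    4 / radius a' c' * (`|a - a'| + `|c - c'|) ^+ 2.
Proof.
move=> sl; have h := radius_phi_error a' c' sl.
case: sl => hg hm g02 m02 _.
set d := `|a - a'| + `|c - c'| in h *.
have d0 : 0 <= d by rewrite addr_ge0.
have rl := radius_lipschitz a c a' c'.
have rg := radius_ge0 a c; have rg' := radius_ge0 a' c'.
have E2d : `|phi_error a c g m a' c'| <= 2 * d.
  rewrite (_ : phi_error a c g m a' c' =
    (1 - g) * (a - a') + (1 - m) * (c - c') - (radius a c - radius a' c'));
    last by rewrite /phi_error !phiE; ring.
  have n1 : `|1 - g| <= 1 by rewrite ler_norml; lra.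
  have n2 : `|1 - m| <= 1 by rewrite ler_norml; lra.
  have p1 := ler_wpM2r (normr_ge0 (a - a')) n1.
  have p2 := ler_wpM2r (normr_ge0 (c - c')) n2.
  apply: le_trans (ler_normB _ _) _.
  have := ler_normD ((1 - g) * (a - a')) ((1 - m) * (c - c')).
  rewrite !normrM /d in rl *; lra.
have [r'0|r'_neq0] := eqVneq (radius a' c') 0.
  have [a'0 c'0] := radius_eq0 r'0.
  have -> : phi_error a c g m a' c' = 0.
    rewrite /phi_error !phiE r'0 a'0 c'0 !subr0 !addr0.
    have s := sqr_radius a c; have s' := sqr_radius a' c'.
    have [r0|rn0] := eqVneq (radius a c) 0.
      by have [a0 c0] := radius_eq0 r0; rewrite r0 a0 c0; ring.
    apply: (mulfI rn0); rewrite mulr0.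
    have e0 : eps ^+ 2 = 0 by move: s'; rewrite r'0 a'0 c'0; lra.
    rewrite e0 in s; ring: hg hm s.
  by rewrite normr0 r'0 invr0 mulr0 mul0r.
have r'0 : 0 < radius a' c' by rewrite lt_def r'_neq0.
rewrite mulrAC ler_pdivlMr//.
have [hr|hr] := leP (radius a' c' / 2) (radius a c).
  rewrite normrM (ger0_norm rg) in h.
  have := ler_wpM2r (normr_ge0 (phi_error a c g m a' c')) hr.
  have := sqr_ge0 d; lra.
have : radius a' c' / 2 <= d.
  by move: rl; rewrite -/d distrC => /(le_trans (ler_norm _)); lra.
move=> hd; have := ler_pM (normr_ge0 _) _ E2d hd.
move=> /(_ ltac:(lra)); rewrite expr2; lra.
Qed.

(** Replaces the Lipschitz continuity of the gradient, which fails at the kink: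
    multiplied by r', the estimate stays uniform down to r' = 0.  Subtracting
    the slope equation at (a, c) leaves (1 - g) (r - r') - (a - a'). *)
Lemma slope_defect a c g m a' c' : slope a c g m ->
  `|radius a' c' * g - (radius a' c' - a')| <= 2 * (`|a - a'| + `|c - c'|) /\
  `|radius a' c' * m - (radius a' c' - c')| <= 2 * (`|a - a'| + `|c - c'|).
Proof.
move=> [hg hm g02 m02 _].
have rl := radius_lipschitz a c a' c'.
have aux u u' s : radius a c * s = radius a c - u -> 0 <= s <= 2 ->
    `|u - u'| <= `|a - a'| + `|c - c'| ->
    `|radius a' c' * s - (radius a' c' - u')| <= 2 * (`|a - a'| + `|c - c'|).
  move=> hs s02 hu.
  have -> : radius a' c' * s - (radius a' c' - u') =
     (1 - s) * (radius a c - radius a' c') - (u - u') by ring: hs.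
  have n1 : `|1 - s| <= 1 by rewrite ler_norml; lra.
  have n2 := ler_wpM2r (normr_ge0 (radius a c - radius a' c')) n1.
  apply: le_trans (ler_normB _ _) _; rewrite normrM; lra.
by split; [apply: (aux a a' g)|apply: (aux c c' m)]; rewrite // ?lerDl ?lerDr.
Qed.

End FischerBurmeister.

(** * Gradients and Clarke gradients *)

Lemma cvg_sumr (R : realType) (T : Type) (F : set_system T) (FF : Filter F)
    (I : Type) (s : seq I) (f : I -> T -> R) (l : I -> R) :
  (forall i, f i x @[x --> F] --> l i) ->
  \sum_(i <- s) f i x @[x --> F] --> \sum_(i <- s) l i.
Proof.
move=> fl; elim: s => [|i s IH].
  by rewrite big_nil; under eq_fun do rewrite big_nil; exact: cvg_cst.
rewrite big_cons; under eq_fun do rewrite big_cons.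
exact: cvgD (fl i) IH.
Qed.

Section Gradients.
Context (R : realType) (N : nat).
Implicit Types (f : 'cV[R]_N -> R) (u v w x y : 'cV[R]_N).

Definition dot u y : R := (u^T *m y) 0 0.

Lemma dotE u y : dot u y = \sum_(j < N) u j 0 * y j 0.
Proof. by rewrite /dot mxE; apply: eq_bigr => j _; rewrite mxE. Qed.

Lemma dotDl u v y : dot (u + v) y = dot u y + dot v y.
Proof. by rewrite /dot linearD mulmxDl mxE. Qed.

Lemma dotZl k u y : dot (k *: u) y = k * dot u y.
Proof. by rewrite /dot linearZ -scalemxAl mxE. Qed.

Lemma dotDr u y y' : dot u (y + y') = dot u y + dot u y'.
Proof. by rewrite /dot mulmxDr mxE. Qed.

Lemma dotZr k u y : dot u (k *: y) = k * dot u y.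
Proof. by rewrite /dot -scalemxAr mxE. Qed.

Lemma dot_delta u j : dot u (delta_mx j 0) = u j 0.
Proof. by rewrite /dot -colE !mxE. Qed.

Lemma cvg_coord (y : nat -> 'cV[R]_N) x j :
  y @ \oo --> x -> (fun k => y k j 0) @ \oo --> x j 0.
Proof.
by move=> yx; exact: (cvg_comp _ _ yx (@coord_continuous _ _ _ j 0 x)).
Qed.

Lemma cvg_dot (y : nat -> 'cV[R]_N) x u :
  y @ \oo --> x -> (fun k => dot u (y k)) @ \oo --> dot u x.
Proof.
move=> yx; rewrite dotE; under eq_fun do rewrite dotE.
apply: cvg_sumr => j; apply: cvgM; first exact: cvg_cst.
exact: cvg_coord.
Qed.

(** A two-sided quadratic error bound determines the directional derivative, so
    the inequalities for phi replace any differentiation of the square root. *)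
Lemma derive_quadratic_error f x v (d C : R) :
  (forall h : R, `|f (h *: v + x) - f x - h * d| <= C * h ^+ 2) -> 'D_v f x = d.
Proof.
move=> hd; apply: cvg_lim => //.
apply/cvgrPdist_le => e e0.
have C0 : 0 <= C by have := hd 1; rewrite expr1n mulr1; exact: le_trans.
near=> h.
have h0 : h != 0 by near: h; exact: nbhs_dnbhs_neq.
have hs : `|h| <= e / (C + 1).
  near: h; apply: (@dnbhs0_le _ R^o); rewrite divr_gt0//; lra.
rewrite /= distrC.
have -> : h^-1 *: (f (h *: v + x) - f x) - d =
  h^-1 * (f (h *: v + x) - f x - h * d) by rewrite /GRing.scale/=; field.
rewrite normrM normfV mulrC ler_pdivrMr ?normr_gt0//.
apply: le_trans (hd h) _; rewrite -(@real_normK _ h) ?num_real// expr2 mulrA.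
apply: ler_wpM2r => //.
apply: le_trans (ler_wpM2l C0 hs) _.
rewrite mulrA ler_pdivrMr; lra || nra.
Unshelve. all: by end_near. Qed.

Lemma gradient_quadratic_error f x u :
  (forall v, exists C : R, forall h : R,
     `|f (h *: v + x) - f x - h * dot u v| <= C * h ^+ 2) ->
  gradient f x = u.
Proof.
move=> hu; apply/colP => j; rewrite mxE -(dot_delta u).
by have [D hD] := hu (delta_mx j 0); apply: derive_quadratic_error hD.
Qed.

Lemma gradient_affine f u c x : (forall y, f y = dot u y + c) -> gradient f x = u.
Proof.
move=> fE; apply: gradient_quadratic_error => // v; exists 0 => h.
by rewrite !fE dotDr dotZr mul0r (_ : _ - _ = 0) ?normr0//; ring.
Qed.

End Gradients.

Section ClarkeGradient.
Context (R : realType) (N : nat).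
Implicit Types (f : 'cV[R]_N -> R) (u v w x y : 'cV[R]_N).

Lemma clarke_gradient_sub f x (S : set 'cV[R]_N) :
  (forall u v (k : R), S u -> S v -> 0 <= k <= 1 -> S (k *: u + (1 - k) *: v)) ->
  limiting_gradients f x `<=` S -> clarke_gradient f x `<=` S.
Proof.
move=> Sconv; apply: smallest_sub => u v k; rewrite !inE => Su Sv.
by apply: Sconv => //; rewrite ge0 le1.
Qed.

Lemma clarke_gradient_affine f u c x : (forall y, f y = dot u y + c) ->
  clarke_gradient f x `<=` [set u].
Proof.
move=> fE; apply: clarke_gradient_sub => [_ _ k -> -> _|xi [y [_ _ gxi]]].
  by rewrite /= -scalerDl addrC subrK scale1r.
move: gxi; under eq_fun do rewrite (gradient_affine _ fE).
by move=> /(cvg_unique _ (@cvg_cst _ _ _ _ _)) => ->.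
Qed.

(* From here on phi is composed with two affine functions of linear parts
   [al] and [ka]; the direction [v] moves the first argument alone. *)
Context (eps : R) (al ka v : 'cV[R]_N) (a0 c0 : R).
Context (alv : dot al v = 1) (kav : dot ka v = 0).

Let a y := dot al y + a0.
Let c y := dot ka y + c0.
Let g y := phi eps (a y) (c y).

Let aD h w y : a (h *: w + y) = a y + h * dot al w.
Proof. by rewrite /a dotDr dotZr; ring. Qed.

Let cD h w y : c (h *: w + y) = c y + h * dot ka w.
Proof. by rewrite /c dotDr dotZr; ring. Qed.

Lemma gradient_phi_smooth y : let r := radius eps (a y) (c y) in 0 < r ->
  gradient g y = (1 - a y / r) *: al + (1 - c y / r) *: ka.
Proof.
move=> r r0; apply: gradient_quadratic_error => w.
set D := `|dot al w| + `|dot ka w|.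
exists (D ^+ 2 / 2 / r) => h.
have := radius_phi_error (a (h *: w + y)) (c (h *: w + y)) (slope_smooth r0).
rewrite -/r normrM (gtr0_norm r0) mulrC -ler_pdivlMr//.
rewrite -normrN /phi_error -/(g _) -/(g _) !aD !cD.
rewrite dotDl !dotZl => h1.
apply: (le_trans (le_trans _ h1)); last first.
  rewrite (_ : _ - _ = - (h * dot al w)); last by ring.
  rewrite (_ : c y - _ = - (h * dot ka w)); last by ring.
  rewrite !normrN !normrM -mulrDr exprMn real_normK ?num_real//.
  by rewrite le_eqVlt -!/D; apply/orP; left; apply/eqP; ring.
by rewrite le_eqVlt; apply/orP; left; apply/eqP; congr Num.norm; ring.
Qed.

(** At the kink, the function is h - |h| along the direction [v]. *)
Lemma phi_kink_not_differentiable y :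
  radius eps (a y) (c y) = 0 -> ~ differentiable g y.
Proof.
move=> r0 /(@diff_derivable _ _ _ _ _ v) dg.
have [a_0 c_0] := radius_eq0 r0.
have eps0 : eps ^+ 2 = 0.
  by have := sqr_radius eps (a y) (c y); rewrite r0 a_0 c_0; lra.
have gE h : g (h *: v + y) - g y = h - `|h|.
  rewrite /g !phiE r0 aD cD a_0 c_0 alv kav /radius eps0.
  by rewrite mulr1 mulr0 !add0r expr0n/= !addr0 sqrtr_sqr; ring.
move: dg; rewrite /derivable => /cvg_ex[l /cvgrPdist_lt/(_ _ ltr01)].
rewrite /dnbhs /within /= => /nbhs_ballP[e /= e0 he].
have e20 : 0 < e / 2 by lra.
have := he (e / 2); have := he (- (e / 2)).
rewrite -ball_normE /= !sub0r !normrN (gtr0_norm e20) !gE normrN (gtr0_norm e20).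
rewrite oppr_eq0 (gt_eqF e20) /GRing.scale/=.
move=> /(_ ltac:(lra) isT) h1 /(_ ltac:(lra) isT).
rewrite subrr mulr0 subr0 => h2.
have : `|l - 2| < 1 by apply: le_lt_trans h1; rewrite (_ : _ * _ = 2)//; field; lra.
move: h2; rewrite !ltr_norml; lra.
Qed.

(** Gradients at nearby smooth points are combinations gm al + mu ka with
    (gm, mu) a slope.  If the radius at [x] is positive, these coefficients
    converge.  At the kink, pairing with [v] recovers the limit of gm, and a
    nonzero coordinate of [ka] that of mu; if [ka] = 0 any admissible mu will
    do. *)
Lemma limiting_gradient_phi x : limiting_gradients g x `<=`
  [set xi | exists gm mu, slope eps (a x) (c x) gm mu /\ xi = gm *: al + mu *: ka].
Proof.
move=> xi [y [dg yx gxi]].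
pose r z := radius eps (a z) (c z).
have ay : (fun k => a (y k)) @ \oo --> a x.
  by apply: cvgD; [exact: cvg_dot|exact: cvg_cst].
have cy : (fun k => c (y k)) @ \oo --> c x.
  by apply: cvgD; [exact: cvg_dot|exact: cvg_cst].
have ry : (fun k => r (y k)) @ \oo --> r x.
  have r2y : (fun k => a (y k) ^+ 2 + c (y k) ^+ 2 + eps ^+ 2) @ \oo -->
      a x ^+ 2 + c x ^+ 2 + eps ^+ 2.
    by apply: cvgD; [apply: cvgD; apply: cvgM|exact: cvg_cst].
  exact: (cvg_comp _ _ r2y (@sqrt_continuous R _)).
pose gm k : R := 1 - a (y k) / r (y k); pose mu k : R := 1 - c (y k) / r (y k).
have r0 k : 0 < r (y k).
  rewrite lt_def radius_ge0 andbT; apply/eqP => /phi_kink_not_differentiable.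
  exact.
have sl k : slope eps (a (y k)) (c (y k)) (gm k) (mu k) := slope_smooth (r0 k).
have gE k : gradient g (y k) = gm k *: al + mu k *: ka := gradient_phi_smooth (r0 k).
have cvg_comb (p q : nat -> R) (p' q' : R) : p @ \oo --> p' -> q @ \oo --> q' ->
    (fun k => p k *: al + q k *: ka) @ \oo --> p' *: al + q' *: ka.
  by move=> pp' qq'; apply: cvgD; exact: cvgZr_tmp.
have gxi' : (fun k => gm k *: al + mu k *: ka) @ \oo --> xi.
  by move: gxi; under [X in X @ _]eq_fun do rewrite gE.
have xiE (p q : R) : (fun k => gm k *: al + mu k *: ka) @ \oo --> p *: al + q *: ka ->
    xi = p *: al + q *: ka.
  exact: cvg_unique gxi'.
have [rx0|rx_neq0] := eqVneq (r x) 0; last first.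
  have rx0 : 0 < r x by rewrite lt_def rx_neq0 radius_ge0.
  exists (1 - a x / r x), (1 - c x / r x); split; first exact: slope_smooth.
  apply: xiE; apply: cvg_comb; (apply: cvgB; first exact: cvg_cst);
    by apply: cvgM => //; apply: cvgV.
have kink p q : 0 <= p <= 2 -> 0 <= q <= 2 -> 1 / 2 <= p + q ->
    slope eps (a x) (c x) p q.
  have [ax cx] := radius_eq0 rx0; rewrite -/(r x) in rx0.
  by split; rewrite // -/(r x) rx0 ?ax ?cx !mul0r subrr.
have gmv : gm @ \oo --> dot v xi.
  have dotC (p q : 'cV[R]_N) : dot p q = dot q p.
    by rewrite !dotE; apply: eq_bigr => j _; rewrite mulrC.
  have -> : gm = fun k => dot v (gradient g (y k)).
    by apply/funext => k; rewrite gE dotDr !dotZr ![dot v _]dotC alv kav; ring.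
  exact: cvg_dot.
have g02 : 0 <= dot v xi <= 2.
  apply/andP; split.
    by apply: (cvgr_to_ge gmv); apply: nearW => k; have [_ _ /andP[]] := sl k.
  by apply: (cvgr_to_le gmv); apply: nearW => k; have [_ _ /andP[]] := sl k.
have [ka0|/cV0Pn[j kaj]] := eqVneq ka 0.
  (* The term mu ka vanishes; the value 1 satisfies the box constraints. *)
  exists (dot v xi), 1; split; first by apply: kink; lra.
  apply: xiE; apply: cvgD; first exact: cvgZr_tmp.
  rewrite (_ : (fun k => mu k *: ka) = cst (1 *: ka)); first exact: cvg_cst.
  by apply/funext => k; rewrite ka0 !scaler0.
have muv : mu @ \oo --> (xi j 0 - dot v xi * al j 0) / ka j 0.
  have -> : mu = fun k => (gradient g (y k) j 0 - gm k * al j 0) / ka j 0.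
    by apply/funext => k; rewrite gE !mxE; field.
  apply: cvgM; last exact: cvg_cst.
  apply: cvgB; first exact: cvg_coord.
  by apply: cvgM => //; exact: cvg_cst.
exists (dot v xi), ((xi j 0 - dot v xi * al j 0) / ka j 0); split.
  apply: kink => //.
    apply/andP; split.
      by apply: (cvgr_to_ge muv); apply: nearW => k; have [_ _ _ /andP[]] := sl k.
    by apply: (cvgr_to_le muv); apply: nearW => k; have [_ _ _ /andP[]] := sl k.
  by apply: (cvgr_to_ge (cvgD gmv muv)); apply: nearW => k; have [_ _ _ _] := sl k.
by apply: xiE; apply: cvg_comb.
Qed.

(** The slopes at a point form a convex set, so passing from limiting gradients to
    their convex hull adds nothing. *)
Lemma clarke_gradient_phi x : clarke_gradient g x `<=`
  [set xi | exists gm mu, slope eps (a x) (c x) gm mu /\ xi = gm *: al + mu *: ka].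
Proof.
apply: clarke_gradient_sub; last exact: limiting_gradient_phi.
move=> _ _ k [g1 [m1 [s1 ->]]] [g2 [m2 [s2 ->]]] k01.
exists (k * g1 + (1 - k) * g2), (k * m1 + (1 - k) * m2); split; last first.
  by rewrite !scalerDr !scalerA addrACA -!scalerDl.
case: s1 s2 => [e1 f1 h1 i1 j1] [e2 f2 h2 i2 j2].
split; [| |nra|nra|nra].
  by rewrite mulrDr mulrCA e1 mulrCA e2; ring.
by rewrite mulrDr mulrCA f1 mulrCA f2; ring.
Qed.

End ClarkeGradient.

(** * The sup norm and the two-norm of matrices *)

Section MatrixNorm.
Context (R : realType).

Lemma mx_norm_coord m n (M : 'M[R]_(m, n)) i j : `|M i j| <= `|M|.
Proof.
rewrite [leRHS]/Num.norm /= mx_normrE; apply/bigmax_geP; right.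
by exists (i, j).
Qed.

Lemma mx_norm_le m n (M : 'M[R]_(m, n)) (c : R) :
  0 <= c -> (forall i j, `|M i j| <= c) -> `|M| <= c.
Proof.
move=> c0 Mc; rewrite [leLHS]/Num.norm /= mx_normrE.
by apply/bigmax_leP; split=> // -[i j] _; exact: Mc.
Qed.

Lemma mulmx_norm_le m n p (M : 'M[R]_(m, n)) (B : 'M[R]_(n, p)) :
  `|M *m B| <= n%:R * `|M| * `|B|.
Proof.
apply: mx_norm_le => [|i j]; first by rewrite !mulr_ge0.
rewrite mxE; apply: le_trans (ler_norm_sum _ _ _) _.
apply: (@le_trans _ _ (\sum_(k < n) `|M| * `|B|)).
  by apply: ler_sum => k _; rewrite normrM ler_pM// mx_norm_coord.
by rewrite sumr_const card_ord -mulrA mulr_natl.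
Qed.

Lemma le_norm_norm2 N (x : 'cV[R]_N) : `|x| <= norm2 x.
Proof.
apply: mx_norm_le => [|i j]; first exact: sqrtr_ge0.
rewrite ord1 -(sqrtr_sqr (x i 0)) ler_wsqrtr//.
by rewrite (bigD1 i)//= lerDl sumr_ge0// => k _; exact: sqr_ge0.
Qed.

Lemma le_norm2_norm N (x : 'cV[R]_N) : norm2 x <= N%:R * `|x|.
Proof.
rewrite -(@ler_pXn2r _ 2)// ?nnegrE ?mulr_ge0 ?sqrtr_ge0//.
rewrite sqr_sqrtr; last by apply: sumr_ge0 => i _; exact: sqr_ge0.
apply: (@le_trans _ _ (N%:R * `|x| ^+ 2)).
  rewrite mulr_natl -[N in _ *+ N]card_ord -sumr_const; apply: ler_sum => i _.
  by rewrite -[leLHS]real_normK ?num_real// lerXn2r ?nnegrE ?mx_norm_coord.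
rewrite exprMn ler_wpM2r ?sqr_ge0// -natrX ler_nat.
by case: (N) => // k; rewrite expnS expn1 leq_pmulr.
Qed.

End MatrixNorm.

(** * C-differentials of the Fischer-Burmeister map *)

Section Derivatives.
Context (R : realType) (n q : nat).
Context (H : 'M[R]_n) (f : 'cV[R]_n) (A : 'M[R]_(q, n)) (b : 'cV[R]_q).
Implicit Types (g m : 'cV[R]_q) (x w : 'cV[R]_(n + q)).

Definition newton_mx g m : 'M[R]_(n + q) :=
  block_mx H A^T (- (diag_mx m^T *m A)) (diag_mx g^T).

Lemma newton_mxE g m w : newton_mx g m *m w =
  col_mx (H *m usubmx w + A^T *m dsubmx w)
    (\col_i (g i 0 * dsubmx w i 0 - m i 0 * (A *m usubmx w) i 0)).
Proof.
rewrite -[w in LHS]vsubmxK mul_block_col; congr col_mx.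
apply/colP => i; rewrite mulNmx -mulmxA !mul_diag_mx !mxE.
by rewrite addrC.
Qed.

Definition fb_slopes eps x g m : Prop :=
  forall i, slope eps (dsubmx x i 0) (slack A b (usubmx x) i 0) (g i 0) (m i 0).

(** The first n components are affine, so their rows are forced.  In the others
    the multiplier v_i moves the first argument of phi and leaves the second one
    alone, as [clarke_gradient_phi] demands. *)
Lemma C_differential_FB eps x (V : 'M[R]_(n + q)) :
  C_differential (FB H f A b eps) x V ->
  exists g m, V = newton_mx g m /\ fb_slopes eps x g m.
Proof.
move=> CV.
have top i : (row (lshift q i) V)^T = (row i (row_mx H A^T))^T.
  apply: (@clarke_gradient_affine _ _ _ _ (f i 0) x _ _ (CV (lshift q i))) => y.
  rewrite /FB col_mxEu /dot trmxK -row_mul -[y in RHS]vsubmxK mul_row_col.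
  by rewrite !mxE; ring.
pose al i : 'cV[R]_(n + q) := delta_mx (rshift n i) 0.
pose ka i : 'cV[R]_(n + q) := col_mx (- (row i A)^T) 0.
have bot i : exists gm : R * R,
    slope eps (dsubmx x i 0) (slack A b (usubmx x) i 0) gm.1 gm.2 /\
    (row (rshift n i) V)^T = gm.1 *: al i + gm.2 *: ka i.
  have alE y : dot (al i) y + 0 = dsubmx y i 0.
    by rewrite addr0 /dot trmx_delta -rowE !mxE.
  have kaE y : dot (ka i) y + b i 0 = slack A b (usubmx y) i 0.
    rewrite /dot tr_col_mx linearN/= trmxK trmx0 -[y in LHS]vsubmxK mul_row_col.
    by rewrite mul0mx addr0 mulNmx -row_mul !mxE addrC.
  have alal : dot (al i) (al i) = 1 by rewrite dot_delta mxE !eqxx.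
  have kaal : dot (ka i) (al i) = 0 by rewrite dot_delta /ka col_mxEd mxE.
  have := CV (rshift n i).
  rewrite (_ : (fun y => _) =
    fun y => phi eps (dot (al i) y + 0) (dot (ka i) y + b i 0)); last first.
    by apply/funext => y; rewrite alE kaE /FB col_mxEd mxE.
  move=> /(clarke_gradient_phi alal kaal)[gi [mi []]].
  by rewrite alE kaE => s e; exists (gi, mi).
have [gm gmE] := choice bot.
exists (\col_i (gm i).1), (\col_i (gm i).2); split; last first.
  move=> i; rewrite [X in slope _ _ _ X _]mxE [X in slope _ _ _ _ X]mxE.
  by have [] := gmE i.
have topE i j : V (lshift q i) j = row_mx H A^T i j.
  by have /colP/(_ j) := top i; rewrite !mxE.
have botE i j : V (rshift n i) j = (gm i).1 * al i j 0 + (gm i).2 * ka i j 0.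
  by have [_ /colP/(_ j)] := gmE i; rewrite !mxE.
rewrite -[LHS]submxK; congr block_mx; apply/matrixP => i j.
- by rewrite !mxE topE row_mxEl.
- by rewrite !mxE topE row_mxEr mxE.
- rewrite mul_diag_mx !mxE botE /al /ka col_mxEu !mxE eq_lrshift.
  by rewrite mulr0 add0r mulrN.
- rewrite !mxE botE /al /ka col_mxEd !mxE mulr0 addr0 eqxx andbT.
  by rewrite (inj_eq (@rshift_inj _ _)) eq_sym; case: eqP => _;
    rewrite ?mulr1 ?mulr0 ?mulr1n ?mulr0n.
Qed.

Lemma jacobian_regularizer delta x g m :
  newton_mx g m + jacobian_col (regularizer A b delta) x =
  newton_mx (g + const_mx delta) (m + const_mx delta).
Proof.
have -> : jacobian_col (regularizer A b delta) x =
    block_mx 0 0 (- (delta *: A)) (delta%:M).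
  apply/row_matrixP => i; rewrite rowK; apply: trmx_inj; rewrite trmxK.
  set B := block_mx _ _ _ _.
  apply: (@gradient_affine _ _ _ _ ((col_mx 0 (delta *: b) : 'cV[R]_(n + q)) i 0)) => y.
  have -> : regularizer A b delta y = B *m y + col_mx 0 (delta *: b).
    rewrite -[y in RHS]vsubmxK mul_block_col !mul0mx add_col_mx !addr0.
    rewrite mulNmx -scalemxAl mul_scalar_mx /regularizer /slack.
    by rewrite !scalerDr scalerN; congr col_mx; rewrite addrA addrC addrA.
  by rewrite mxE /dot trmxK -row_mul [row i _ _ _]mxE.
rewrite /newton_mx add_block_mx !addr0; congr block_mx.
  rewrite linearD/= linearD/= mulmxDl opprD; congr (_ - _).
  by rewrite trmx_const diag_const_mx mul_scalar_mx.
by rewrite linearD/= linearD/= trmx_const diag_const_mx.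
Qed.

End Derivatives.

(** * Nonsingularity at the root *)

Section Kernel.
Context (R : realType) (n q : nat).
Context (H : 'M[R]_n) (f : 'cV[R]_n) (A : 'M[R]_(q, n)) (b : 'cV[R]_q).
Context (H_psd : psd H).
Implicit Types (z dz : 'cV[R]_n) (v dv g m : 'cV[R]_q).

Lemma quad_form_balance dz dv : H *m dz + A^T *m dv = 0 ->
  (dz^T *m H *m dz) 0 0 + \sum_i dv i 0 * (A *m dz) i 0 = 0.
Proof.
move=> e; have -> : \sum_i dv i 0 * (A *m dz) i 0 = (dz^T *m (A^T *m dv)) 0 0.
  rewrite mulmxA -trmx_mul mxE; apply: eq_bigr => i _.
  by rewrite [_^T _ _]mxE mulrC.
transitivity ((dz^T *m (H *m dz) + dz^T *m (A^T *m dv)) 0 0).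
  by rewrite -mulmxA [RHS]mxE.
by rewrite -mulmxDr e mulmx0 mxE.
Qed.

(** The quadratic form and the products are nonnegative and sum to zero. *)
Lemma monotone_complementarity dz dv : H *m dz + A^T *m dv = 0 ->
  (forall i, 0 <= dv i 0 * (A *m dz) i 0) ->
  (dz^T *m H *m dz) 0 0 = 0 /\ forall i, dv i 0 * (A *m dz) i 0 = 0.
Proof.
move=> /quad_form_balance/eqP + dvA.
have [_ /(_ dz) Hdz] := H_psd.
rewrite paddr_eq0// ?sumr_ge0// => /andP[/eqP-> /eqP s0]; split=> // i.
by move/psumr_eq0P : s0 => /(_ _)->.
Qed.

Lemma licq_inj z dv : licq A b z -> A^T *m dv = 0 ->
  (forall i, i \notin active A b z -> dv i 0 = 0) -> dv = 0.
Proof.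
move=> Afree Adv dvN.
have : \row_k dv (enum_val k) 0 *m
    rowsub (fun k : 'I_#|active A b z| => enum_val k) A = 0.
  apply/rowP => j; rewrite !mxE.
  under eq_bigr do rewrite !mxE.
  rewrite -(big_enum_val (fun i => dv i 0 * A i j)) /=.
  transitivity ((A^T *m dv) j 0); last by rewrite Adv mxE.
  rewrite [RHS]mxE.
  rewrite [RHS](bigID (mem (active A b z)))/= [X in _ + X]big1 ?addr0.
    by apply: eq_bigr => i _; rewrite mxE mulrC.
  by move=> i /dvN ->; rewrite mulr0.
move=> /eqP; rewrite mulmx_free_eq0// => /eqP/rowP dv0.
apply/colP => i; rewrite mxE; have [iz|/dvN//] := boolP (i \in active A b z).
by have := dv0 (enum_rank_in iz i); rewrite !mxE enum_rankK_in.
Qed.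

Context (zh : 'cV[R]_n) (vh : 'cV[R]_q).
Context (kkt : kkt_point H f A b zh vh) (sosc : strong_sosc H A b zh vh).
Context (Alicq : licq A b zh).

(** The common core of uniqueness of the KKT point and of nonsingularity at it:
    the strong second order condition forces dz = 0, and then LICQ forces
    dv = 0. *)
Lemma strong_regularity_kernel dz dv : H *m dz + A^T *m dv = 0 ->
  (dz^T *m H *m dz) 0 0 = 0 ->
  (forall i, i \in active A b zh -> 0 < vh i 0 -> (A *m dz) i 0 = 0) ->
  (forall i, i \notin active A b zh -> dv i 0 = 0) ->
  dz = 0 /\ dv = 0.
Proof.
move=> e Hdz0 strong inactive.
have dz0 : dz = 0.
  apply/eqP/negPn/negP => /sosc; rewrite Hdz0 ltxx => /(_ _)/negP; apply=> // i ia vi.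
  by apply/colP => j; rewrite ord1 -row_mul !mxE; have := strong i ia vi; rewrite !mxE.
split=> //; apply: licq_inj Alicq _ inactive.
by move: e; rewrite dz0 mulmx0 add0r.
Qed.

Lemma activeP z i : (i \in active A b z) = (slack A b z i 0 == 0).
Proof. by rewrite inE /slack !mxE subr_eq0 eq_sym. Qed.

(** For two KKT points, the difference (dz, dv) satisfies
    dv_i (A dz)_i = v_i y'_i + v'_i y_i >= 0, so monotonicity makes every mixed
    product vanish and [strong_regularity_kernel] applies. *)
Lemma kkt_point_unique z v : kkt_point H f A b z v -> z = zh /\ v = vh.
Proof.
move=> [st cp]; have [sth cph] := kkt.
have e : H *m (z - zh) + A^T *m (v - vh) = 0.
  rewrite !mulmxBr addrACA -opprD -[RHS](subrr 0) -{1}st -sth.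
  by apply/colP => i; rewrite !mxE; ring.
have AE i : (A *m (z - zh)) i 0 = slack A b zh i 0 - slack A b z i 0.
  by rewrite /slack mulmxBr !mxE; ring.
have pE i : (v - vh) i 0 * (A *m (z - zh)) i 0 =
    v i 0 * slack A b zh i 0 + vh i 0 * slack A b z i 0.
  rewrite AE; have [_ _ c1] := cp i; have [_ _ c2] := cph i.
  by rewrite [(v - vh) _ _]mxE [(- vh) _ _]mxE; ring: c1 c2.
have pos i : 0 <= v i 0 * slack A b zh i 0 /\ 0 <= vh i 0 * slack A b z i 0.
  by have [v0 s0 _] := cp i; have [vh0 sh0 _] := cph i; rewrite !mulr_ge0.
have [|Hd p0] := monotone_complementarity e.
  by move=> i; rewrite pE; have [? ?] := pos i; rewrite addr_ge0.
have c0 i : v i 0 * slack A b zh i 0 = 0 /\ vh i 0 * slack A b z i 0 = 0.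
  by have := p0 i; rewrite pE; have [? ?] := pos i => ?; split; lra.
have [||dz0 dv0] := strong_regularity_kernel e Hd.
- move=> i; rewrite activeP AE => /eqP -> vi; have [_ /eqP] := c0 i.
  by rewrite mulf_eq0 (gt_eqF vi) => /eqP ->; rewrite subrr.
- move=> i; rewrite activeP => /negPf si.
  have [/eqP + _] := c0 i; have [_ _ /eqP] := cph i.
  by rewrite !mulf_eq0 si !orbF => /eqP vhi /eqP vi; rewrite !mxE vhi vi subrr.
by split; apply/eqP; rewrite -subr_eq0; apply/eqP.
Qed.

Lemma FB0_kkt_point (xs : 'cV[R]_(n + q)) :
  FB H f A b 0 xs = 0 -> kkt_point H f A b (usubmx xs) (dsubmx xs).
Proof.
rewrite /FB -[0 in RHS]col_mx0 => /eq_col_mx[st cp]; split=> // i.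
move/colP/(_ i) : cp; rewrite mxE [RHS]mxE phiE.
set a := dsubmx xs i 0; set c := slack _ _ _ _ _ => h.
have := radius_ge0 0 a c; have := sqr_radius 0 a c.
have -> : radius 0 a c = a + c by lra.
have := sqr_ge0 a; have := sqr_ge0 c => c2 a2 s r0.
have ac : a * c = 0 by move: s; rewrite expr0n/= !expr2; lra.
have [a0|a_neq0] := eqVneq a 0.
  by split; rewrite // ?a0 //; rewrite a0 in r0; lra.
have c0 : c = 0 by move/eqP: ac; rewrite mulf_eq0 (negPf a_neq0) => /eqP.
by split; rewrite // ?c0 //; rewrite c0 in r0; lra.
Qed.

Context (A3 : trivial_joint_kernel H A).

Lemma sqr_radius_axis (a c u : R) :
  radius 0 a c ^+ 2 = u ^+ 2 + 0 ^+ 2 + 0 ^+ 2 -> 0 <= u -> radius 0 a c = u.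
Proof.
rewrite expr0n/= !addr0 => ru u0; apply/eqP.
by rewrite -(@eqrXn2 _ 2)// ?radius_ge0// ru.
Qed.

(** From g_i dv_i = m_i (A dz)_i with nonnegative coefficients that are not both
    zero, the product dv_i (A dz)_i is nonnegative, hence zero.  So m_i > 0
    forces (A dz)_i = 0 and g_i > 0 forces dv_i = 0.  For eps > 0 both hold at
    every i; for eps = 0 the first holds at strongly active constraints, where
    g_i = 0, and the second at inactive ones, where m_i = 0. *)
Lemma newton_mx_inj eps (xs w : 'cV[R]_(n + q)) g m :
  0 <= eps -> FB H f A b eps xs = 0 ->
  let rs i := radius eps (dsubmx xs i 0) (slack A b (usubmx xs) i 0) in
  (forall i, [/\ 0 <= g i 0, 0 <= m i 0, 0 < g i 0 + m i 0,
      rs i * g i 0 = rs i - dsubmx xs i 0 &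
      rs i * m i 0 = rs i - slack A b (usubmx xs) i 0]) ->
  newton_mx H A g m *m w = 0 -> w = 0.
Proof.
move=> eps0 root rs gm; rewrite newton_mxE -(@col_mx0 R n q 1) => /eq_col_mx[].
rewrite -{5}[w]vsubmxK; move: (usubmx w) (dsubmx w) => dz dv e cp.
have cpE i : g i 0 * dv i 0 = m i 0 * (A *m dz) i 0.
  by move/colP/(_ i): cp; rewrite [LHS]mxE [RHS]mxE => /eqP; rewrite subr_eq0 => /eqP.
have gp i : g i 0 * (dv i 0 * (A *m dz) i 0) = m i 0 * (A *m dz) i 0 ^+ 2.
  by rewrite mulrA cpE; ring.
have mp i : m i 0 * (dv i 0 * (A *m dz) i 0) = g i 0 * dv i 0 ^+ 2.
  by rewrite mulrCA -cpE; ring.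
have [|Hd p0] := monotone_complementarity e.
  move=> i; have [g0 m0 gm0 _ _] := gm i; rewrite -(pmulr_rge0 _ gm0) mulrDl gp mp.
  by rewrite addr_ge0// mulr_ge0// sqr_ge0.
have mA i : 0 < m i 0 -> (A *m dz) i 0 = 0.
  move=> m0; apply/eqP; rewrite -sqrf_eq0; apply/eqP.
  by apply: (mulfI (lt0r_neq0 m0)); rewrite -gp p0 !mulr0.
have gv i : 0 < g i 0 -> dv i 0 = 0.
  move=> g0; apply/eqP; rewrite -sqrf_eq0; apply/eqP.
  by apply: (mulfI (lt0r_neq0 g0)); rewrite -mp p0 !mulr0.
suff [-> ->] : dz = 0 /\ dv = 0 by [].
have [eps_0|eps_neq0] := eqVneq eps 0; last first.
  have r_gt i u : u = dsubmx xs i 0 \/ u = slack A b (usubmx xs) i 0 -> 0 < rs i - u.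
    move=> uE; rewrite subr_gt0 ltNge; apply/negP => ru.
    have e2 : 0 < eps ^+ 2 by rewrite exprn_even_gt0.
    have := sqr_radius eps (dsubmx xs i 0) (slack A b (usubmx xs) i 0).
    have := radius_ge0 eps (dsubmx xs i 0) (slack A b (usubmx xs) i 0).
    have := sqr_ge0 (dsubmx xs i 0); have := sqr_ge0 (slack A b (usubmx xs) i 0).
    rewrite -/(rs i) => s2 a2 r0 rE.
    have : rs i ^+ 2 <= u ^+ 2 by rewrite lerXn2r ?nnegrE ?(le_trans r0).
    by case: uE => ->; lra.
  have pos (p r : R) : 0 <= p -> 0 < r * p -> 0 < p.
    by rewrite le_eqVlt => /predU1P[<-|//]; rewrite mulr0 ltxx.
  have dv0 : dv = 0.
    apply/colP => i; rewrite mxE; apply: gv; have [g0 _ _ ge _] := gm i.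
    by apply: (pos _ (rs i) g0); rewrite ge; apply: r_gt; left.
  have Adz0 : A *m dz = 0.
    apply/colP => i; rewrite [RHS]mxE; apply: mA; have [_ m0 _ _ me] := gm i.
    by apply: (pos _ (rs i) m0); rewrite me; apply: r_gt; right.
  by split=> //; apply: A3 => //; move: e; rewrite dv0 mulmx0 addr0.
have [ze ve] : usubmx xs = zh /\ dsubmx xs = vh.
  by apply: kkt_point_unique; apply: FB0_kkt_point; rewrite -eps_0.
have [_ cph] := kkt.
apply: strong_regularity_kernel => // i; rewrite activeP.
- move=> /eqP si vi; apply: mA; have [g0 m0 gm0] := gm i.
  have := sqr_radius eps (dsubmx xs i 0) (slack A b (usubmx xs) i 0).
  rewrite /rs ze ve si eps_0 => r2 rg _.
  have rE := sqr_radius_axis r2 (ltW vi).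
  move/eqP: rg; rewrite rE subrr mulf_eq0 (gt_eqF vi)/= => /eqP g_0.
  by rewrite g_0 add0r in gm0.
- move=> si; apply: gv; have [g0 m0 gm0] := gm i; have [_ s0 c0] := cph i.
  have sp : 0 < slack A b zh i 0 by rewrite lt_def si.
  move/eqP: c0; rewrite mulf_eq0 (negPf si) orbF => /eqP v0.
  have := sqr_radius eps (dsubmx xs i 0) (slack A b (usubmx xs) i 0).
  rewrite /rs ze ve v0 eps_0 => r2 _ rm.
  have rE : radius 0 0 (slack A b zh i 0) = slack A b zh i 0.
    by apply: sqr_radius_axis s0; rewrite r2; ring.
  move/eqP: rm; rewrite rE subrr mulf_eq0 (negPf si)/= => /eqP m_0.
  by rewrite m_0 addr0 in gm0.
Qed.

End Kernel.

(** * From nonsingularity to a uniform bound *)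

Section UniformRegularity.
Context (R : realType) (n q : nat) (H : 'M[R]_n) (A : 'M[R]_(q, n)).
Context (r a c : 'I_q -> R).
Implicit Types (g m : 'cV[R]_q) (w : 'cV[R]_(n + q)).

(** The box constraints of [slope], with an upper bound [B] that leaves room for
    adding the regularization parameter. *)
Definition slope_box (B : R) g m : Prop :=
  forall i, [/\ 0 <= g i 0 <= B, 0 <= m i 0 <= B & 1 / 2 <= g i 0 + m i 0].

Definition slope_defect_sum g m : R :=
  \sum_i (`|r i * g i 0 - (r i - a i)| + `|r i * m i 0 - (r i - c i)|).

Lemma slope_defect_sum_ge0 g m : 0 <= slope_defect_sum g m.
Proof. by apply: sumr_ge0 => i _; rewrite addr_ge0. Qed.

Let space : Type := ('rV[R]_q * 'rV[R]_q * 'rV[R]_(n + q))%type.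

(** Zero on the box exactly when the parameters are slopes for (r, a, c) and the matrix
   annihilates the vector.  The last sum penalizes g + m < 1/2, since
   s + |s| = 2 max(s, 0), and so keeps the compact domain a plain box. *)
Let residual (p : space) : R :=
  \sum_j `|(newton_mx H A p.1.1^T p.1.2^T *m p.2^T) j 0| +
  slope_defect_sum p.1.1^T p.1.2^T +
  \sum_i (1 / 2 - p.1.1 0 i - p.1.2 0 i + `|1 / 2 - p.1.1 0 i - p.1.2 0 i|).

Let residual_continuous : continuous (residual : space -> R).
Proof.
move=> p.
have gc i : (fun x : space => x.1.1 0 i) @ p --> p.1.1 0 i.
  apply: (@continuous_comp space _ _ (fun x : space => x.1.1)
    (fun M : 'rV[R]_q => M 0 i)).
    by apply: continuous_comp; exact: cvg_fst.
  exact: coord_continuous.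
have mc i : (fun x : space => x.1.2 0 i) @ p --> p.1.2 0 i.
  apply: (@continuous_comp space _ _ (fun x : space => x.1.2)
    (fun M : 'rV[R]_q => M 0 i)).
    by apply: continuous_comp; [exact: cvg_fst|exact: cvg_snd].
  exact: coord_continuous.
have wc i : (fun x : space => x.2 0 i) @ p --> p.2 0 i.
  apply: (@continuous_comp space _ _ (fun x : space => x.2)
    (fun M : 'rV[R]_(n + q) => M 0 i)).
    exact: cvg_snd.
  exact: coord_continuous.
have gtc i : (fun x : space => x.1.1^T i 0) @ p --> p.1.1^T i 0.
  rewrite mxE (_ : (fun _ => _) = fun x : space => x.1.1 0 i)//.
  by apply/funext => x; rewrite mxE.
have mtc i : (fun x : space => x.1.2^T i 0) @ p --> p.1.2^T i 0.
  rewrite mxE (_ : (fun _ => _) = fun x : space => x.1.2 0 i)//.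
  by apply/funext => x; rewrite mxE.
have wtc i : (fun x : space => x.2^T i 0) @ p --> p.2^T i 0.
  rewrite mxE (_ : (fun _ => _) = fun x : space => x.2 0 i)//.
  by apply/funext => x; rewrite mxE.
have Nc j k : (fun x : space => newton_mx H A x.1.1^T x.1.2^T j k) @ p -->
    newton_mx H A p.1.1^T p.1.2^T j k.
  rewrite /newton_mx.
  case: (split_ordP j) => j' ->; case: (split_ordP k) => k' ->.
  - by under eq_fun do rewrite block_mxEul; rewrite block_mxEul; exact: cvg_cst.
  - by under eq_fun do rewrite block_mxEur; rewrite block_mxEur; exact: cvg_cst.
  - under eq_fun do rewrite block_mxEdl trmxK mul_diag_mx 2!mxE.
    rewrite block_mxEdl trmxK mul_diag_mx 2!mxE.
    by apply: cvgN; apply: cvgM => //; exact: cvg_cst.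
  - under eq_fun do rewrite block_mxEdr trmxK mxE.
    by rewrite block_mxEdr trmxK mxE; apply: cvgMn.
have affc (u : space -> R) l (s t : R) : u @ p --> l ->
    (fun x => `|s * u x - t|) @ p --> `|s * l - t|.
  move=> ul; apply: cvg_norm; apply: cvgB; last exact: cvg_cst.
  by apply: cvgM => //; exact: cvg_cst.
have sc i : (fun x : space => 1 / 2 - x.1.1 0 i - x.1.2 0 i) @ p -->
    1 / 2 - p.1.1 0 i - p.1.2 0 i.
  by apply: cvgB => //; apply: cvgB => //; exact: cvg_cst.
apply: cvgD; first apply: cvgD.
- apply: cvg_sumr => j; apply: cvg_norm; rewrite mxE; under eq_fun do rewrite mxE.
  by apply: cvg_sumr => k; apply: cvgM; [exact: Nc|exact: wtc].
- apply: cvg_sumr => i; apply: cvgD.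
    exact: (affc _ _ _ _ (gtc i)).
  exact: (affc _ _ _ _ (mtc i)).
- by apply: cvg_sumr => i; apply: cvgD => //; exact: cvg_norm.
Qed.

(** The constant is the minimum of the residual over the box times the unit
    sphere.  Having the defect on the right-hand side avoids speaking of
    neighbourhoods of the set of slopes at the root. *)
Lemma uniform_regularity (B : R) : 0 <= B ->
  (forall g m w, slope_box B g m -> slope_defect_sum g m = 0 ->
     newton_mx H A g m *m w = 0 -> w = 0) ->
  exists2 k : R, 0 < k & forall g m w, slope_box B g m ->
    k * `|w| <= (n + q)%:R * `|newton_mx H A g m *m w| +
                slope_defect_sum g m * `|w|.
Proof.
move=> B0 inj.
pose K : set space := ([set v : 'rV_q | forall i, `[0, B]%classic (v 0 i)] `*`
   [set v : 'rV_q | forall i, `[0, B]%classic (v 0 i)]) `*`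
   [set v : 'rV_(n + q) | `|v| = 1].
have Kcompact : compact K.
  apply: compact_setX; first by apply: compact_setX;
    apply: (@rV_compact R q (fun=> `[0, B]%classic)) => _; exact: segment_compact.
  apply: bounded_closed_compact.
    by exists 1; split; [exact: num_real|move=> M M1 v /= ->; exact: ltW].
  rewrite (_ : mkset _ = (fun v : 'rV_(n + q) => `|v|) @^-1` [set 1]); last by [].
  by apply: closed_comp => [v _|]; [exact: norm_continuous|exact: closed_eq].
have penalty_ge0 (t : R) : 0 <= t + `|t|.
  by have := ler_norm (- t); rewrite normrN; lra.
have residual_pos p : K p -> 0 < residual p.
  move=> [[/= g0B m0B] w1]; rewrite lt_def !addr_ge0 ?slope_defect_sum_ge0 ?sumr_ge0//.
  rewrite andbT; apply/eqP => /eqP.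
  rewrite paddr_eq0 ?addr_ge0 ?slope_defect_sum_ge0 ?sumr_ge0//.
  rewrite paddr_eq0 ?slope_defect_sum_ge0 ?sumr_ge0//.
  move=> /andP[/andP[/eqP N0 /eqP S0] /eqP P0].
  suff w0 : p.2^T = 0.
    by move: w1; rewrite -[p.2]trmxK w0 trmx0 normr0 => /esym/eqP; rewrite oner_eq0.
  apply: (inj p.1.1^T p.1.2^T) => // [i|].
    rewrite !mxE; have := g0B i; have := m0B i; rewrite /= !in_itv/=.
    move=> -> ->; split=> //.
    move/psumr_eq0P : P0 => /(_ (fun i _ => penalty_ge0 _) i isT).
    have := normr_ge0 (1 / 2 - p.1.1 0 i - p.1.2 0 i); lra.
  apply/colP => j; rewrite [RHS]mxE; apply/eqP; rewrite -normr_eq0; apply/eqP.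
  by move/psumr_eq0P : N0 => /(_ (fun i _ => normr_ge0 _) j isT).
have norm_tr w : `|w^T| = `|w|.
  apply/eqP; rewrite eq_le; apply/andP; split; apply: mx_norm_le => // i j.
    by rewrite mxE mx_norm_coord.
  by have := mx_norm_coord w^T j i; rewrite mxE.
have Kmem g m w : slope_box B g m -> w != 0 -> K (g^T, m^T, `|w|^-1 *: w^T).
  move=> gm w0; split; first by split=> i /=; rewrite mxE in_itv/=; have [] := gm i.
  by rewrite /= normrZ norm_tr normfV normr_id mulVf// normr_eq0.
have [K0|Kempty] := pselect (K !=set0); last first.
  exists 1 => // g m w gm; have [->|w0] := eqVneq w 0; last first.
    by case: Kempty; exists (g^T, m^T, `|w|^-1 *: w^T); exact: Kmem.
  by rewrite normr0 !mulr0 addr0 !mulr_ge0.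
have [p pK pmin] :=
  compact_EVT_min K0 Kcompact (continuous_subspaceT residual_continuous).
exists (residual p) => [|g m w gm]; first by apply: residual_pos; rewrite inE in pK.
have [->|w0] := eqVneq w 0; first by rewrite mulmx0 !normr0 !mulr0 addr0.
have wp : 0 < `|w| by rewrite normr_gt0.
have := pmin _ (mem_set (Kmem _ _ _ gm w0)); rewrite -(ler_pM2r wp).
move=> /le_trans; apply; rewrite /residual /= !trmxK !linearZ/= trmxK.
rewrite [X in (_ + X) * _]big1 ?addr0; last first.
  move=> i _; rewrite !mxE; have [_ _ h] := gm i.
  by rewrite ler0_norm; lra.
rewrite mulrDl lerD2r mulr_suml.
apply: (@le_trans _ _ (\sum_(j < n + q) `|newton_mx H A g m *m w|)).
  apply: ler_sum => j _; rewrite mxE normrM normfV normr_id.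
  by rewrite mulrAC mulVf ?mul1r ?mx_norm_coord// normr_eq0.
by rewrite sumr_const card_ord mulr_natl.
Qed.

End UniformRegularity.

(** * Estimates around the root *)

Section LocalEstimates.
Context (R : realType) (n q : nat).
Context (H : 'M[R]_n) (f : 'cV[R]_n) (A : 'M[R]_(q, n)) (b : 'cV[R]_q).
Context (eps : R).
Implicit Types (g m : 'cV[R]_q) (x y w : 'cV[R]_(n + q)).

Local Notation F := (FB H f A b eps).

Lemma col_norm_le x (c : R) : 0 <= c ->
  `|usubmx x| <= c -> (forall i, `|dsubmx x i 0| <= c) -> `|x| <= c.
Proof.
move=> c0 xu xd; apply: mx_norm_le => // i j; rewrite ord1.
case: (split_ordP i) => k ->.
  by have := le_trans (mx_norm_coord (usubmx x) k 0) xu; rewrite mxE.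
by have := xd k; rewrite mxE.
Qed.

Lemma usubmx_norm_le x : `|usubmx x| <= `|x|.
Proof. by apply: mx_norm_le => // i j; rewrite mxE mx_norm_coord. Qed.

Lemma dsubmx_norm_le x : `|dsubmx x| <= `|x|.
Proof. by apply: mx_norm_le => // i j; rewrite mxE mx_norm_coord. Qed.

(** A Lipschitz constant of x |-> (v_i, y_i), from the sup norm to the l1 norm. *)
Definition pair_lip : R := 1 + n%:R * `|A|.

Lemma pair_lip_gt0 : 0 < pair_lip.
Proof. by rewrite /pair_lip ltr_pwDl// mulr_ge0. Qed.

Lemma pair_norm_le w i :
  `|dsubmx w i 0| + `|(A *m usubmx w) i 0| <= pair_lip * `|w|.
Proof.
rewrite /pair_lip mulrDl mul1r lerD//.
  exact: le_trans (mx_norm_coord _ _ _) (dsubmx_norm_le _).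
apply: le_trans (mx_norm_coord _ _ _) _; apply: le_trans (mulmx_norm_le _ _) _.
by rewrite ler_wpM2l ?mulr_ge0// usubmx_norm_le.
Qed.

Lemma mulmx_usubmxB x y i : (A *m usubmx (x - y)) i 0 =
  - (slack A b (usubmx x) i 0 - slack A b (usubmx y) i 0).
Proof.
rewrite (linearB usubmx)/= mulmxBr /slack !mxE opprB opprD opprK addrACA subrr.
by rewrite add0r addrC.
Qed.

Lemma pair_lipschitz x y i :
  `|dsubmx x i 0 - dsubmx y i 0| +
  `|slack A b (usubmx x) i 0 - slack A b (usubmx y) i 0|
    <= pair_lip * `|x - y|.
Proof.
apply: le_trans (pair_norm_le (x - y) i).
rewrite le_eqVlt; apply/orP; left; apply/eqP; congr (_ + _).
  by rewrite !mxE.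
by rewrite mulmx_usubmxB normrN.
Qed.

Lemma col_subE (u v : 'I_q -> R) i : (\col_j u j - \col_j v j) i 0 = u i - v i.
Proof. by rewrite !mxE. Qed.

Lemma FB_subE x y : F x - F y =
  col_mx (H *m usubmx (x - y) + A^T *m dsubmx (x - y))
    (\col_i (phi eps (dsubmx x i 0) (slack A b (usubmx x) i 0) -
             phi eps (dsubmx y i 0) (slack A b (usubmx y) i 0))).
Proof.
rewrite /FB opp_col_mx add_col_mx; congr col_mx; last first.
  apply/colP => i; rewrite [LHS]mxE [RHS]mxE [X in X + _]mxE [X in _ + X]mxE.
  by rewrite [X in - X]mxE.
rewrite (linearB usubmx) (linearB dsubmx) /= !mulmxBr.
by apply/colP => i; rewrite !mxE; ring.
Qed.

Lemma FB_lipschitz x y :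
  `|F x - F y| <= (n%:R * `|H| + q%:R * `|A^T| + 2 * pair_lip) * `|x - y|.
Proof.
have p0 := pair_lip_gt0; have e0 := normr_ge0 (x - y).
have HA0 : 0 <= n%:R * `|H| + q%:R * `|A^T| by rewrite addr_ge0// mulr_ge0.
rewrite FB_subE; apply: col_norm_le => [||i].
- by rewrite mulr_ge0// addr_ge0// mulr_ge0// ltW.
- rewrite col_mxKu; apply: le_trans (ler_normD _ _) _.
  have h1 := mulmx_norm_le H (usubmx (x - y)).
  have h2 := mulmx_norm_le A^T (dsubmx (x - y)).
  have h3 : n%:R * `|H| * `|usubmx (x - y)| <= n%:R * `|H| * `|x - y|.
    by rewrite ler_wpM2l ?mulr_ge0// usubmx_norm_le.
  have h4 : q%:R * `|A^T| * `|dsubmx (x - y)| <= q%:R * `|A^T| * `|x - y|.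
    by rewrite ler_wpM2l ?mulr_ge0// dsubmx_norm_le.
  have h5 : 0 <= pair_lip * `|x - y| by rewrite mulr_ge0// ltW.
  rewrite !mulrDl; lra.
- rewrite col_mxKd mxE; apply: le_trans (phi_lipschitz _ _ _ _ _) _.
  have := pair_lipschitz x y i.
  have h5 : 0 <= (n%:R * `|H| + q%:R * `|A^T|) * `|x - y| by rewrite mulr_ge0.
  rewrite [X in _ -> _ <= X]mulrDl; lra.
Qed.

Lemma FB_linearization x y g m : fb_slopes A b eps x g m ->
  `|F x - F y - newton_mx H A g m *m (x - y)| <=
    (\sum_i 4 / radius eps (dsubmx y i 0) (slack A b (usubmx y) i 0)) *
      pair_lip ^+ 2 * `|x - y| ^+ 2.
Proof.
move=> sl.
have r0 i : 0 <= 4 / radius eps (dsubmx y i 0) (slack A b (usubmx y) i 0).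
  by rewrite divr_ge0// radius_ge0.
rewrite FB_subE newton_mxE opp_col_mx add_col_mx subrr -mulrA -exprMn.
apply: col_norm_le => [||i].
- by rewrite mulr_ge0 ?sqr_ge0// sumr_ge0.
- by rewrite col_mxKu normr0 mulr_ge0 ?sqr_ge0// sumr_ge0.
rewrite col_mxKd col_subE.
have -> : dsubmx (x - y) i 0 = dsubmx x i 0 - dsubmx y i 0 by rewrite !mxE.
rewrite mulmx_usubmxB mulrN opprK.
apply: le_trans (phi_linearization _ _ (sl i)) _.
apply: ler_pM => //.
  by rewrite [leRHS](bigD1 i)//= lerDl sumr_ge0.
by rewrite lerXn2r ?nnegrE ?addr_ge0 ?mulr_ge0 ?(ltW pair_lip_gt0) ?pair_lipschitz.
Qed.

Local Notation defect y := (slope_defect_sum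
  (fun i => radius eps (dsubmx y i 0) (slack A b (usubmx y) i 0))
  (fun i => dsubmx y i 0) (fun i => slack A b (usubmx y) i 0)).

Lemma slope_defect_sum_le x y g m (delta : R) : 0 <= delta ->
  fb_slopes A b eps x g m ->
  defect y (g + const_mx delta) (m + const_mx delta) <=
    \sum_(i < q) (4 * pair_lip * `|x - y| +
       2 * radius eps (dsubmx y i 0) (slack A b (usubmx y) i 0) * delta).
Proof.
move=> d0 sl; apply: ler_sum => i _.
have [] := slope_defect (dsubmx y i 0) (slack A b (usubmx y) i 0) (sl i).
set r := radius eps (dsubmx y i 0) _; have r0 : 0 <= r := radius_ge0 _ _ _.
have := pair_lipschitz x y i.
rewrite [(g + _) i 0]mxE [(m + _) i 0]mxE ![const_mx _ i 0]mxE !(mulrDr r).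
rewrite ![r * _ + r * delta - _]addrAC => h h1 h2.
have n1 := ler_normD (r * g i 0 - (r - dsubmx y i 0)) (r * delta).
have n2 := ler_normD (r * m i 0 - (r - slack A b (usubmx y) i 0)) (r * delta).
have n3 : `|r * delta| = r * delta by rewrite ger0_norm ?mulr_ge0.
rewrite n3 in n1 n2; lra.
Qed.

Lemma newton_mx_shift g m (delta : R) w : 0 <= delta ->
  `|newton_mx H A (g + const_mx delta) (m + const_mx delta) *m w -
    newton_mx H A g m *m w| <= delta * (pair_lip * `|w|).
Proof.
move=> d0; have c0 : 0 <= delta * (pair_lip * `|w|).
  by rewrite !mulr_ge0// ltW// pair_lip_gt0.
rewrite !newton_mxE opp_col_mx add_col_mx subrr; apply: col_norm_le => // [|i].
  by rewrite col_mxKu normr0.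
rewrite col_mxKd col_subE [(g + _) i 0]mxE [(m + _) i 0]mxE ![const_mx _ i 0]mxE.
rewrite (_ : _ - _ = delta * (dsubmx w i 0 - (A *m usubmx w) i 0)); last by ring.
rewrite normrM (ger0_norm d0) ler_wpM2l//.
exact: le_trans (ler_normB _ _) (pair_norm_le _ _).
Qed.

End LocalEstimates.

(** * Local convergence of the globalized iteration *)

Lemma ler_sqr_ge0 (R : realType) (u v : R) : 0 <= u -> u <= v -> u ^+ 2 <= v ^+ 2.
Proof. by move=> u0 uv; rewrite lerXn2r// ?nnegrE// (le_trans u0 uv). Qed.

Lemma near_right0_mul_le (R : realType) (c d : R) :
  0 < d -> \forall r \near 0^'+, c * r <= d.
Proof.
move=> d0; near=> r.
have r0 : 0 < r by near: r; exact: nbhs_right_gt.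
have : r <= d / (`|c| + 1).
  by near: r; apply: nbhs_right_le; rewrite divr_gt0// ltr_wpDl.
rewrite ler_pdivlMr ?ltr_wpDl// => h.
have := ler_norm c; nra.
Unshelve. all: by end_near. Qed.

Section LocalConvergence.
Context (R : realType) (n q : nat).
Context (H : 'M[R]_n) (f : 'cV[R]_n) (A : 'M[R]_(q, n)) (b : 'cV[R]_q).
Context (eps : R) (xs : 'cV[R]_(n + q)) (root : FB H f A b eps xs = 0).
Implicit Types (g m : 'cV[R]_q) (x w dx : 'cV[R]_(n + q)) (V : 'M[R]_(n + q)).

Local Notation F := (FB H f A b eps).
Local Notation rs i := (radius eps (dsubmx xs i 0) (slack A b (usubmx xs) i 0)).
Local Notation defect := (slope_defect_sum
  (fun i => rs i) (fun i => dsubmx xs i 0) (fun i => slack A b (usubmx xs) i 0)).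

Context (k : R) (k_gt0 : 0 < k).
Context (regular : forall g m w, slope_box 3 g m ->
    k * `|w| <= (n + q)%:R * `|newton_mx H A g m *m w| + defect g m * `|w|).

(** With K the regularized matrix and e = x - xs, the step satisfies
    K (e + dx) = (V e - F x) + (K - V) e, where both terms are O(|e|^2): the first
    by semismoothness, the second because K - V is of order delta = O(|e|).
    The lower bound on |F x| is the same regularity applied to V e. *)
Lemma newton_step_bounds : exists C kap : R, [/\ 0 <= C, 0 < kap &
  \forall rho \near 0^'+, forall x V (delta : R) dx,
    `|x - xs| <= rho -> C_differential F x V ->
    0 <= delta <= norm2 (F x) ->
    (V + jacobian_col (regularizer A b delta) x) *m dx = - F x ->
    `|x + dx - xs| <= C * `|x - xs| ^+ 2 /\ kap * `|x - xs| <= `|F x| ].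
Proof.
pose N : R := (n + q)%:R; have N0 : 0 <= N by exact: ler0n.
pose L := n%:R * `|H| + q%:R * `|A^T| + 2 * pair_lip A.
have p0 := ltW (pair_lip_gt0 A).
have L0 : 0 <= L by rewrite addr_ge0 ?mulr_ge0// addr_ge0 ?mulr_ge0.
pose C1 := (\sum_i 4 / rs i) * pair_lip A ^+ 2.
have C10 : 0 <= C1.
  apply: mulr_ge0; last exact: sqr_ge0.
  by apply: sumr_ge0 => i _; rewrite divr_ge0// radius_ge0.
pose D := \sum_(i < q) (4 * pair_lip A + 2 * rs i * (N * L)).
have NL0 : 0 <= N * L by exact: mulr_ge0.
have C0 : 0 <= 2 * N / k * (C1 + N * L * pair_lip A).
  by apply: mulr_ge0; [rewrite divr_ge0 ?mulr_ge0// ltW|rewrite addr_ge0// mulr_ge0].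
exists (2 * N / k * (C1 + N * L * pair_lip A)), (k / (4 * (N + 1))); split => //.
  by rewrite divr_gt0// mulr_gt0// ltr_wpDl.
have k2 : 0 < k / 2 by rewrite divr_gt0.
have k4 : 0 < k / 4 by rewrite divr_gt0.
near=> rho => x V delta dx xrho /C_differential_FB[g [m [-> sl]]] /andP[d0 dF] step.
have rho1 : N * L * rho <= 1 by near: rho; exact: near_right0_mul_le ltr01.
have rho2 : D * rho <= k / 2 by near: rho; exact: near_right0_mul_le k2.
have rho3 : N * C1 * rho <= k / 4 by near: rho; exact: near_right0_mul_le k4.
have D0 : 0 <= D.
  by apply: sumr_ge0 => i _; rewrite addr_ge0 ?mulr_ge0// radius_ge0.
set e := x - xs in xrho *; have e0 : 0 <= `|e| by exact: normr_ge0.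
have dNL : delta <= N * L * `|e|.
  apply: le_trans dF _; apply: le_trans (le_norm2_norm _) _.
  rewrite -/N -mulrA ler_wpM2l//.
  by have := FB_lipschitz H f A b eps x xs; rewrite root subr0.
have bound (d : R) w : 0 <= d <= N * L * `|e| ->
    k / 2 * `|w| <= N * `|newton_mx H A (g + const_mx d) (m + const_mx d) *m w|.
  move=> /andP[dd0 dd1].
  have d1 : d <= 1.
    by apply: le_trans dd1 _; apply: le_trans rho1; rewrite ler_wpM2l.
  have box : slope_box 3 (g + const_mx d) (m + const_mx d).
    by move=> i; have [_ _] := sl i; rewrite !mxE => ? ? ?; split; lra.
  have := regular w box.
  have : defect (g + const_mx d) (m + const_mx d) <= k / 2.
    apply: le_trans (slope_defect_sum_le xs dd0 sl) _; apply: le_trans rho2.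
    apply: (@le_trans _ _ (D * `|e|)); last by rewrite ler_wpM2l.
    rewrite mulr_suml; apply: ler_sum => i _.
    rewrite -/e [leRHS]mulrDl lerD2l -[leRHS]mulrA.
    by rewrite ler_wpM2l// mulr_ge0// radius_ge0.
  move=> /(ler_wpM2r (normr_ge0 w)); rewrite -/N; lra.
have lin : `|F x - newton_mx H A g m *m e| <= C1 * `|e| ^+ 2.
  by have := FB_linearization H f xs sl; rewrite root subr0.
split; last first.
  have := bound 0 e.
  rewrite (_ : const_mx 0 = 0); last by apply/matrixP => i j; rewrite !mxE.
  rewrite !addr0 lexx mulr_ge0// => /(_ isT) h1.
  have h2 : `|newton_mx H A g m *m e| <= `|F x| + C1 * `|e| ^+ 2.
    by rewrite -lerBlDl; apply: le_trans lin; rewrite distrC; exact: lerB_dist.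
  have h3 := ler_wpM2l N0 h2.
  have h4 : N * C1 * `|e| <= k / 4.
    by apply: le_trans rho3; rewrite ler_wpM2l// mulr_ge0.
  have h5 := ler_wpM2r e0 h4.
  rewrite mulrAC ler_pdivrMr ?mulr_gt0 ?ltr_wpDl//.
  rewrite expr2 in h3.
  have := normr_ge0 (F x); nra.
rewrite jacobian_regularizer in step.
have := bound delta (x + dx - xs); rewrite d0 dNL => /(_ isT).
have -> : x + dx - xs = e + dx by rewrite /e addrAC.
rewrite mulmxDr step => h1.
have h2 : `|newton_mx H A (g + const_mx delta) (m + const_mx delta) *m e - F x|
    <= (C1 + N * L * pair_lip A) * `|e| ^+ 2.
  rewrite -(subrK (newton_mx H A g m *m e) (newton_mx H A (g + _) _ *m e)) -addrA.
  apply: le_trans (ler_normD _ _) _; rewrite [X in _ + X]distrC.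
  have h3 := newton_mx_shift H A g m e d0.
  have h4 : delta * (pair_lip A * `|e|) <= N * L * `|e| * (pair_lip A * `|e|).
    by rewrite ler_wpM2r ?mulr_ge0.
  rewrite mulrDl; lra.
have h3 := le_trans h1 (ler_wpM2l N0 h2).
rewrite (_ : _ * _ = 2 / k * (N * ((C1 + N * L * pair_lip A) * `|e| ^+ 2)));
  last by ring.
by rewrite mulrAC ler_pdivlMr//; lra.
Unshelve. all: by end_near. Qed.

End LocalConvergence.

Section GlobalizedNewton.
Context (R : realType) (n q : nat).
Context (H : 'M[R]_n) (f : 'cV[R]_n) (A : 'M[R]_(q, n)) (b : 'cV[R]_q).
Context (eps : R).

Local Notation F := (FB H f A b eps).

Lemma FBRS_delta_bounds (sigma beta delta_init : R)
    (x dx : nat -> 'cV[R]_(n + q)) (delta t : nat -> R) V :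
  0 <= delta_init -> FBRS H f A b eps sigma beta delta_init x dx delta t V ->
  forall j, 0 <= delta j <= norm2 (F (x j)).
Proof.
move=> d0 run; have N0 y : 0 <= norm2 (F y) by exact: sqrtr_ge0.
elim=> [|j /andP[dj _]].
  by rewrite (FBRS_delta0 run) le_min d0 N0 ge_min lexx orbT.
by rewrite (FBRS_deltaS run) le_min dj N0 ge_min lexx orbT.
Qed.

(** The merit is at least of order |e|^2 before the step and at most of order
    |e|^4 after it, while 1 - 2 sigma > 0. *)
Lemma full_step_decrease (xs : 'cV[R]_(n + q)) (sigma C kap : R) :
  F xs = 0 -> 0 < sigma -> sigma < 1 / 2 -> 0 < kap ->
  \forall rho \near 0^'+, forall x dx,
    `|x - xs| <= rho -> `|x + dx - xs| <= C * `|x - xs| ^+ 2 ->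
    kap * `|x - xs| <= `|F x| ->
    sufficient_decrease H f A b eps sigma x dx 1.
Proof.
move=> root s0 s1 kap0.
pose N : R := (n + q)%:R; have N0 : 0 <= N by exact: ler0n.
pose L := n%:R * `|H| + q%:R * `|A^T| + 2 * pair_lip A.
have L0 : 0 <= L.
  by rewrite addr_ge0 ?mulr_ge0// ?addr_ge0 ?mulr_ge0// ltW// pair_lip_gt0.
have sk : 0 < (1 - 2 * sigma) * kap by rewrite mulr_gt0//; lra.
have s2 : (1 - 2 * sigma) ^+ 2 <= 1 - 2 * sigma by nra.
near=> rho => x dx; set e := `|x - xs| => xrho h1 h2.
have e0 : 0 <= e by exact: normr_ge0.
have rho1 : N * (L * `|C|) * rho <= (1 - 2 * sigma) * kap.
  by near: rho; exact: near_right0_mul_le sk.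
rewrite /sufficient_decrease scale1r /merit mulr1 [leRHS]mulrCA ler_wpM2l ?invr_ge0//.
have new : norm2 (F (x + dx)) <= (1 - 2 * sigma) * kap * e.
  apply: le_trans (le_norm2_norm _) _.
  have := FB_lipschitz H f A b eps (x + dx) xs; rewrite root subr0 -/L => h3.
  apply: (@le_trans _ _ (N * (L * `|C|) * e * e)); last first.
    by rewrite ler_wpM2r//; apply: le_trans rho1; rewrite ler_wpM2l// !mulr_ge0.
  rewrite -!mulrA ler_wpM2l//; apply: le_trans h3 _; rewrite ler_wpM2l//.
  by apply: le_trans h1 _; rewrite -expr2 ler_wpM2r ?sqr_ge0// ler_norm.
have old : kap * e <= norm2 (F x) := le_trans h2 (le_norm_norm2 _).
have new0 : 0 <= norm2 (F (x + dx)) by exact: sqrtr_ge0.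
have old0 : 0 <= norm2 (F x) by exact: sqrtr_ge0.
have ke0 : 0 <= kap * e by exact: mulr_ge0 (ltW kap0) e0.
apply: (@le_trans _ _ (((1 - 2 * sigma) * (kap * e)) ^+ 2)).
  by rewrite mulrA; exact: ler_sqr_ge0 new0 new.
rewrite exprMn; apply: ler_pM; [exact: sqr_ge0|exact: sqr_ge0|exact: s2|].
exact: ler_sqr_ge0 ke0 old.
Unshelve. all: by end_near. Qed.

Lemma geometric_cvg (x : nat -> 'cV[R]_(n + q)) xs (rho : R) :
  (forall j, `|x j - xs| <= rho * (1 / 2) ^+ j) -> x @ \oo --> xs.
Proof.
move=> xle; apply/cvgrPdist_le => e e0.
have : (fun j => rho * (1 / 2) ^+ j) @ \oo --> rho * 0.
  by apply: cvgM; [exact: cvg_cst|apply: cvg_expr; rewrite ger0_norm; lra].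
rewrite mulr0 => /cvgrPdist_le/(_ e e0); apply: filterS => j.
rewrite sub0r normrN distrC => /(le_trans (ler_norm _)).
exact: le_trans.
Qed.

End GlobalizedNewton.

Theorem theorem2 (R : realType) (n q : nat)
  (H : 'M[R]_n) (f : 'cV[R]_n) (A : 'M[R]_(q, n)) (b : 'cV[R]_q)
  (H_psd : psd H)
  (zh : 'cV[R]_n) (vh : 'cV[R]_q)
  (A1_kkt : kkt_point H f A b zh vh)
  (A1_sosc : strong_sosc H A b zh vh)
  (A2 : licq A b zh)
  (A3 : trivial_joint_kernel H A)
  (eps : R) (eps_ge0 : 0 <= eps)
  (xs : 'cV[R]_(n + q)) (xs_root : FB H f A b eps xs = 0)
  (sigma beta delta_init : R)
  (sigma_gt0 : 0 < sigma) (sigma_lt : sigma < 1 / 2)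
  (beta_gt0 : 0 < beta) (beta_lt1 : beta < 1)
  (delta_init_ge0 : 0 <= delta_init) :
  exists (eta : R) (U : set 'cV[R]_(n + q)),
    [/\ 0 < eta, nbhs xs U &
      forall (x dx : nat -> 'cV[R]_(n + q)) (delta t : nat -> R)
             (V : nat -> 'M[R]_(n + q)),
        FBRS H f A b eps sigma beta delta_init x dx delta t V ->
        U (x 0%N) ->
        [/\ forall k, norm2 (x k.+1 - xs) <= eta * norm2 (x k - xs) ^+ 2,
            forall k, U (x k) &
            converges_quadratically x xs]].
Proof.
pose r i := radius eps (dsubmx xs i 0) (slack A b (usubmx xs) i 0).
have [||k k0 regular] := @uniform_regularity R n q H A r
    (fun i => dsubmx xs i 0) (fun i => slack A b (usubmx xs) i 0) 3.
- by [].
- move=> g m w box /psumr_eq0P D0.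
  apply: (newton_mx_inj H_psd A1_kkt A1_sosc A2 A3 eps_ge0 xs_root) => i.
  have [/andP[g0 _] /andP[m0 _] gm] := box i.
  have /eqP := D0 (fun j _ => addr_ge0 (normr_ge0 _) (normr_ge0 _)) i isT.
  rewrite paddr_eq0// !normr_eq0 !subr_eq0 => /andP[/eqP hg /eqP hm].
  by split=> //; lra.
have [C [kap [C0 kap0 step]]] := newton_step_bounds xs_root k0 regular.
have decrease := full_step_decrease C xs_root sigma_gt0 sigma_lt kap0.
have half : \forall rho \near 0^'+, C * rho <= 1 / 2.
  by apply: near_right0_mul_le; rewrite divr_gt0.
have [rho [[rho0 rhoC] [{}step {}decrease]]] := filter_ex
  (filterI (filterI (nbhs_right_gt (0 : R)) half) (filterI step decrease)).
exists ((n + q)%:R * C + 1), [set x | `|x - xs| <= rho]; split.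
- by rewrite ltr_wpDl// mulr_ge0.
- apply/nbhs_ballP; exists rho => // x; rewrite -ball_normE /= distrC.
  exact: ltW.
move=> x dx delta t V run x0U.
have bounds := FBRS_delta_bounds delta_init_ge0 run.
have VC j : C_differential (FB H f A b eps) (x j) (V j) by exact: (FBRS_V run).
(* The full step passes the line search test, so no backtracking occurs. *)
have full j : `|x j - xs| <= rho ->
    x j.+1 = x j + dx j /\ `|x j.+1 - xs| <= C * `|x j - xs| ^+ 2.
  move=> xj; have [e1 e2] := step _ _ _ _ xj (VC j) (bounds j) (FBRS_dx run j).
  have dec := decrease _ _ xj e1 e2.
  suff -> : x j.+1 = x j + dx j by [].
  rewrite (FBRS_x run); have [[|l] [-> _ rej]] := FBRS_t run j.
    by rewrite expr0 scale1r.
  by case: (rej 0 isT); rewrite expr0.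
have contract j : `|x j - xs| <= rho -> `|x j.+1 - xs| <= 1 / 2 * `|x j - xs|.
  move=> xj; have [_ /le_trans->//] := full j xj.
  by rewrite expr2 mulrA ler_wpM2r// (le_trans _ rhoC)// ler_wpM2l.
have geom j : `|x j - xs| <= rho * (1 / 2) ^+ j.
  elim: j => [|j IH]; first by rewrite expr0 mulr1.
  have pow : (1 / 2 : R) ^+ j <= 1.
    by rewrite exprn_ile1 ?divr_ge0// ler_pdivrMr// mul1r ler1n.
  have /contract/le_trans : `|x j - xs| <= rho.
    by apply: le_trans IH _; rewrite ger_pMr.
  by apply; rewrite exprS mulrCA ler_wpM2l.
have inU j : `|x j - xs| <= rho.
  apply: le_trans (geom j) _; rewrite ger_pMr// exprn_ile1 ?divr_ge0//.
  by rewrite ler_pdivrMr// mul1r ler1n.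
have quad j : norm2 (x j.+1 - xs) <= ((n + q)%:R * C + 1) * norm2 (x j - xs) ^+ 2.
  apply: le_trans (le_norm2_norm _) _; have [_ h] := full j (inU j).
  have n0 : 0 <= norm2 (x j - xs) by exact: sqrtr_ge0.
  apply: (@le_trans _ _ ((n + q)%:R * C * norm2 (x j - xs) ^+ 2)).
    rewrite -mulrA ler_wpM2l//; apply: le_trans h _; rewrite ler_wpM2l//.
    exact: ler_sqr_ge0 (normr_ge0 _) (le_norm_norm2 _).
  by rewrite ler_wpM2r ?sqr_ge0// lerDl.
split=> //; split; first exact: geometric_cvg geom.
by exists ((n + q)%:R * C + 1); apply: nearW.
Qed.
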